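(* Let $q\geq 2$ and $k\geq 2$ be integers, $I$ an instance of $\mathsf{k\,CSP\!-\!q}$ with $n$ variables, and $x,x^*\in\Sigma_q^n$ two solutions of $I$ at Hamming distance $\kappa>k$ from each other. For each $h\in\{0,\ldots,\kappa\}$, let $$N^h(x^*,x)=\left\{y\in\{x^*_1,x_1\}\times\cdots\times\{x^*_n,x_n\}\,:\,d_H(x,y)=h\right\}.$$ Then $$v(I,x^* )=\sum_{h=0}^k(-1)^{k-h}\binom{\kappa-1-h}{k-h}\sum_{y\in N^h(x^*,x)}v(I,y).$$
   Context: Let $\Sigma_q=\{0,1,\ldots,q-1\}$ and $[n]=\{1,\ldots,n\}$. An instance $I$ of $\mathsf{k\,CSP\!-\!q}$ with $n$ variables consists of an integer $m\ge 1$, a goal (maximize or minimize) and, for each $i\in[m]$, a weight $w_i>0$, an integer $1\le k_i\leq \min\{k,n\}$, a strictly increasing sequence $J_i=(i_1,\ldots,i_{k_i})$ of indices of $[n]$, and a function $P_i:\Sigma_q^{k_i}\to\mathbb{R}$. Solutions are vectors $x\in\Sigma_q^n$, with value $v(I,x)=\sum_{i=1}^m w_iP_i(x_{i_1},\ldots,x_{i_{k_i}})$. $d_H(x,y)$ is the Hamming distance, i.e., the number of coordinates on which $x$ and $y$ differ. *)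

(* Defs.v *)
From mathcomp Require Import all_boot all_order all_algebra.
From mathcomp Require Import reals.

Set Implicit Arguments.
Unset Strict Implicit.
Unset Printing Implicit Defensive.

Import GRing.Theory Num.Theory.
Local Open Scope ring_scope.

(* Sigma_q is 'I_q, Sigma_q^n is n.-tuple 'I_q, and the index set [n] is the
   0-based 'I_n. *)

Inductive goal := Maximize | Minimize.

(* Instances of k CSP-q with n variables. *)
Record csp (R : realType) (q k n : nat) := Csp {
  csp_size : nat;
  csp_goal : goal;
  csp_weight : 'I_csp_size -> R;
  csp_arity : 'I_csp_size -> nat;
  csp_support : forall i, (csp_arity i).-tuple 'I_n;
  csp_fun : forall i, (csp_arity i).-tuple 'I_q -> R;
  csp_size_ge1 : (1 <= csp_size)%N;
  csp_weight_gt0 : forall i, 0 < csp_weight i;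
  csp_arity_bounds : forall i, (1 <= csp_arity i <= minn k n)%N;
  csp_support_incr : forall i, sorted (fun a b : 'I_n => (a < b)%N) (csp_support i)
}.

Definition csp_value (R : realType) (q k n : nat) (I : csp R q k n)
    (x : n.-tuple 'I_q) : R :=
  \sum_(i < csp_size I)
    csp_weight i * csp_fun (map_tuple (tnth x) (csp_support i)).

Definition hamming (q n : nat) (x y : n.-tuple 'I_q) : nat :=
  #|[set i : 'I_n | tnth x i != tnth y i]|.

Definition mixed_at (q n h : nat) (xs x : n.-tuple 'I_q) : {set n.-tuple 'I_q} :=
  [set y | [forall i, tnth y i \in [set tnth xs i; tnth x i]]
           && (hamming x y == h)].

(* Main.v *)
Require Import Defs.
From mathcomp Require Import all_boot all_order all_algebra.
From mathcomp Require Import reals.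
From mathcomp Require Import zify.

(** Let D be the set of the kappa coordinates on which x and xs differ. The
    vectors y of the statement are the x_H obtained from x by copying the
    entries of xs on a subset H of D; their distance to x is #|H|, and xs = x_D.
    A constraint sees at most k coordinates, so its value at x_H depends only on
    the trace of H on a set S of size at most k: as a function of the indicator
    variables of H it is a multilinear polynomial of degree at most k. The mean
    of such a function over the subsets of D of size h is a polynomial in h of
    degree at most k (the mean of a monomial of degree t is
    C(h, t) / C(kappa, t)), so its values at h = 0, ..., k determine its value at
    h = kappa, which is the value at x_D. The number
    (-1)^(k-h) C(kappa-1-h, k-h), multiplied by the C(kappa, h) that turns a mean
    into a sum, is the Lagrange coefficient of the node h at the point kappa.

    The proof works with monomials instead of polynomials in h. By linearity it
    is enough to treat the functions H |-> [T \subset H] with #|T| <= k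
    ([extrapolate_superset]), for which the formula is a binomial identity
    ([sum_lagrange_binomial]); an induction on S then reaches every function of
    the trace of H on S ([extrapolate_trace]). *)

Set Implicit Arguments.
Unset Strict Implicit.
Unset Printing Implicit Defensive.

Import GRing.Theory Num.Theory.
Local Open Scope ring_scope.

(** * Binomial identities *)

(** Both sides count the pairs J \subset L of subsets of an N-element set with
    #|J| = j and #|L| = M, the left one choosing J first. *)
Lemma mul_bin_bin (N M j : nat) : (j <= M)%N -> (M <= N)%N ->
  ('C(N, j) * 'C(N - j, M - j) = 'C(N, M) * 'C(M, j))%N.
Proof.
move=> lejM leMN; have lejN := leq_trans lejM leMN; have := bin_fact lejN.
have := bin_fact (leq_sub2r j leMN); rewrite subnBA // subnK //.
have := bin_fact leMN; have := bin_fact lejM.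
set a := 'C(M, j); set b := 'C(N, M); set c := 'C(N - j, _); set d := 'C(N, j).
move=> Ma Nb Njc Nd.
have /eqP : (d * c * (j`! * ((M - j)`! * (N - M)`!))
             = b * a * (j`! * ((M - j)`! * (N - M)`!)))%N.
  by transitivity N`!; [rewrite -Nd -Njc | rewrite -Nb -Ma]; lia.
by rewrite eqn_pmul2r ?muln_gt0 ?fact_gt0 // => /eqP.
Qed.

(** For K > 0, Pascal's rule on 'C(N, j) splits the sum in two. One part is the
    same sum for N - 1 and K - 1. In the other the product of binomials is
    'C(N - 1, K) * 'C(K, j), so it is a multiple of (-1 + 1) ^+ K and vanishes. *)
Lemma sum_lagrange_binomial (R : comNzRingType) (N K : nat) : (K < N)%N ->
  \sum_(j < K.+1) (-1) ^+ (K - j) * 'C(N - 1 - j, K - j)%:R * 'C(N, j)%:R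
    = 1 :> R.
Proof.
elim: K N => [|K IHK] [|N] // ltKN.
  by rewrite big_ord1 subnn !bin0 expr0 !mulr1.
have -> : \sum_(j < K.+2) (-1) ^+ (K.+1 - j) * 'C(N.+1 - 1 - j, K.+1 - j)%:R
            * 'C(N.+1, j)%:R =
    \sum_(j < K.+2) (-1) ^+ (K.+1 - j) * 'C(N - j, K.+1 - j)%:R * 'C(N, j)%:R
  + \sum_(j < K.+1) (-1) ^+ (K - j) * 'C(N - 1 - j, K - j)%:R * 'C(N, j)%:R
    :> R.
  rewrite big_ord_recl [in RHS]big_ord_recl /= !bin0 subn1 /= -addrA.
  congr (_ + _); rewrite -big_split /=; apply: eq_bigr => j _.
  rewrite /bump /= add1n subSS binS natrD mulrDr.
  by congr (_ + _ * _%:R * _); rewrite -subnDA add1n.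
rewrite IHK //.
have -> : \sum_(j < K.+2) (-1) ^+ (K.+1 - j) * 'C(N - j, K.+1 - j)%:R
            * 'C(N, j)%:R = 'C(N, K.+1)%:R * (-1 + 1) ^+ K.+1 :> R.
  rewrite exprDn mulr_sumr; apply: eq_bigr => j _.
  rewrite expr1n mulr1 -mulrA -natrM -(mulr_natr (_ ^+ _)) mulrCA -natrM.
  congr (_ * _%:R).
  by rewrite mulnC mul_bin_bin // -ltnS.
by rewrite addNr expr0n mulr0 add0r.
Qed.

(** * Extrapolation of functions of a set *)

(** H |-> H :\: A maps these sets bijectively onto the subsets of D :\: A with
    h - #|A| elements. *)
Lemma card_subsets_above (T : finType) (D A : {set T}) (h : nat) :
  A \subset D -> (#|A| <= h)%N ->
  #|[set H : {set T} | (A \subset H) && (H \subset D) && (#|H| == h)]|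
    = 'C(#|D| - #|A|, h - #|A|).
Proof.
move=> sAD leAh; rewrite -cardsDS // -cards_draws.
rewrite -(@card_in_imset _ _ (fun H => H :\: A)); last first.
  move=> H1 H2; rewrite !inE => /andP[/andP[sAH1 _] _] /andP[/andP[sAH2 _] _].
  move=> eqH; rewrite -(setID H1 A) -(setID H2 A) eqH.
  by rewrite (setIidPr sAH1) (setIidPr sAH2).
apply: eq_card => B; rewrite [in RHS]inE; apply/imsetP/andP => [[H] | [sBD]].
  rewrite inE => /andP[/andP[sAH sHD] /eqP <-] ->.
  by rewrite setSD // cardsDS.
move: sBD; rewrite subsetD => /andP[sBD dBA] /eqP cB.
exists (A :|: B); last by rewrite setDUl setDv set0U; apply/esym/setDidPl.
rewrite inE subsetUl subUset sAD sBD /= cardsU.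
by rewrite (disjoint_setI0 _) 1?disjoint_sym // cards0 subn0 cB subnKC.
Qed.

(** The right-hand side of the theorem, for a function g of the subset H of D
    instead of a function of the vector x_H. *)
Definition extrapolate (R : comNzRingType) (T : finType) (D : {set T}) (k : nat)
    (g : {set T} -> R) : R :=
  \sum_(0 <= h < k.+1) (-1) ^+ (k - h) * 'C(#|D| - 1 - h, k - h)%:R
    * \sum_(H : {set T} | (H \subset D) && (#|H| == h)) g H.

Section Extrapolation.

Variables (R : comNzRingType) (T : finType) (D : {set T}) (k : nat).
Implicit Types (A S H : {set T}) (g : {set T} -> R).

Lemma eq_extrapolate g1 g2 : (forall H, H \subset D -> g1 H = g2 H) ->
  extrapolate D k g1 = extrapolate D k g2.
Proof.
move=> eq_g; apply: eq_bigr => h _; congr (_ * _).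
by apply: eq_bigr => H /andP[/eq_g].
Qed.

Lemma extrapolateD g1 g2 :
  extrapolate D k (fun H => g1 H + g2 H)
    = extrapolate D k g1 + extrapolate D k g2.
Proof.
by rewrite -big_split; apply: eq_bigr => h _; rewrite big_split mulrDr.
Qed.

Lemma extrapolateZ c g :
  extrapolate D k (fun H => c * g H) = c * extrapolate D k g.
Proof.
by rewrite mulr_sumr; apply: eq_bigr => h _; rewrite -mulr_sumr mulrCA.
Qed.

Lemma extrapolate_sum (J : Type) (r : seq J) (G : J -> {set T} -> R) :
  extrapolate D k (fun H => \sum_(i <- r) G i H)
    = \sum_(i <- r) extrapolate D k (G i).
Proof.
rewrite [RHS]exchange_big; apply: eq_bigr => h _.
by rewrite exchange_big mulr_sumr.
Qed.

(** The sum over the sets H of size h counts those above A, which are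
    'C(#|D| - #|A|, h - #|A|) in number; with j = h - #|A| the weights are those
    of [sum_lagrange_binomial] for #|D| - #|A| and k - #|A|. *)
Lemma extrapolate_superset A : A \subset D -> (#|A| <= k)%N -> (k < #|D|)%N ->
  extrapolate D k (fun H => (A \subset H)%:R) = 1 :> R.
Proof.
move=> sAD leAk ltkD.
rewrite -[RHS](@sum_lagrange_binomial R (#|D| - #|A|) (k - #|A|));
  last by rewrite ltn_sub2r // (leq_ltn_trans leAk).
have count h : \sum_(H : {set T} | (H \subset D) && (#|H| == h)) (A \subset H)%:R
    = #|[set H : {set T} | (A \subset H) && (H \subset D) && (#|H| == h)]|%:R :> R.
  rewrite -sum1_card natr_sum big_mkcond [RHS]big_mkcond /=.
  by apply: eq_bigr => H _; rewrite inE -andbA; case: (A \subset H); rewrite ?if_same.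
rewrite /extrapolate (@big_cat_nat _ _ _ #|A|) //=; last exact: leqW.
rewrite big_nat big1 ?add0r => [|h /andP[_ lthA]]; last first.
  rewrite count (_ : [set _ | _] = set0) ?cards0 ?mulr0 //; apply/setP => H.
  rewrite !inE; apply: contraTF lthA => /andP[/andP[/subset_leq_card leAH _]].
  by move=> /eqP <-; rewrite -leqNgt.
rewrite -{1}[#|A|]add0n big_addn subSn // big_mkord; apply: eq_bigr => j _.
rewrite count card_subsets_above ?leq_addl // addnK.
by congr (_ ^+ _ * 'C(_, _)%:R * _); lia.
Qed.

(** The factor [A \subset H] is there for the induction, which moves the elements
    of S to A one at a time. For i in S and S' = S :\ i,
    g (H :&: S) = g (H :&: S') + [i \in H] * (g (i |: H :&: S') - g (H :&: S')),
    and [i \in H] * [A \subset H] = [i |: A \subset H]. Hence both terms have the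
    same form with S' for S, the second one for the function
    B |-> g (i |: B) - g B, and the degree bound #|A| + #|S| does not grow. When
    S is empty only a multiple of [A \subset H] is left. *)
Lemma extrapolate_superset_trace S A g : A :|: S \subset D ->
  (#|A| + #|S| <= k)%N -> (k < #|D|)%N ->
  extrapolate D k (fun H => (A \subset H)%:R * g (H :&: S)) = g S.
Proof.
have [m] := ubnP #|S|; elim: m => // m IHm in S A g *; rewrite ltnS => leSm.
move=> sASD leASk ltkD; have [sAD sSD] : A \subset D /\ S \subset D.
  by apply/andP; rewrite -subUset.
have [S0 | [i iS]] := set_0Vmem S.
  rewrite S0 (@eq_extrapolate _ (fun H => g set0 * (A \subset H)%:R)).
    rewrite extrapolateZ extrapolate_superset ?mulr1 //.
    exact: leq_trans (leq_addr _ _) leASk.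
  by move=> H _; rewrite setI0 mulrC.
have cS : #|S| = #|S :\ i|.+1 by rewrite (cardsD1 i) iS.
have sS'D : S :\ i \subset D := subset_trans (subD1set _ _) sSD.
have iD : i \in D := subsetP sSD i iS.
have trace_split H : g (H :&: S) = g (H :&: (S :\ i))
    + (i \in H)%:R * (g (i |: H :&: (S :\ i)) - g (H :&: (S :\ i))).
  have [iH | niH] := boolP (i \in H).
    rewrite mul1r addrC subrK; congr g; apply/setP => j; rewrite !inE.
    by case: eqP => [->|]; rewrite ?iH ?iS.
  rewrite mul0r addr0; congr g; apply/setP => j; rewrite !inE.
  by case: eqP => [->|]; rewrite ?(negPf niH).
rewrite (@eq_extrapolate _ (fun H => (A \subset H)%:R * g (H :&: (S :\ i))
    + (i |: A \subset H)%:R * (g (i |: H :&: (S :\ i)) - g (H :&: (S :\ i)))));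
  last first.
  by move=> H _; rewrite trace_split mulrDr mulrA subUset sub1set -natrM mulnb andbC.
rewrite extrapolateD IHm ?subUset ?sAD //; try lia.
rewrite (IHm _ _ (fun B => g (i |: B) - g B)) ?subUset ?sub1set ?iD ?sAD //;
  [|lia|by rewrite cardsU1; lia].
by rewrite setD1K // addrC subrK.
Qed.

Lemma extrapolate_trace S g : S \subset D -> (#|S| <= k)%N -> (k < #|D|)%N ->
  extrapolate D k (fun H => g (H :&: S)) = g S.
Proof.
move=> sSD leSk ltkD.
have := @extrapolate_superset_trace S set0 g.
rewrite set0U cards0 add0n => <- //.
by apply: eq_extrapolate => H _; rewrite sub0set mul1r.
Qed.

End Extrapolation.

(** * Vectors obtained by overwriting coordinates *)

(** The vector written x_H in the introduction. *)
Definition overwrite (q n : nat) (x xs : n.-tuple 'I_q) (H : {set 'I_n}) :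
    n.-tuple 'I_q :=
  [tuple if i \in H then tnth xs i else tnth x i | i < n].

Section Overwrite.

Variables (q n : nat) (x xs : n.-tuple 'I_q).
Let D : {set 'I_n} := [set i | tnth x i != tnth xs i].

Lemma tnth_overwrite H i :
  tnth (overwrite x xs H) i = if i \in H then tnth xs i else tnth x i.
Proof. by rewrite tnth_mktuple. Qed.

Lemma overwrite_diff : overwrite x xs D = xs.
Proof.
apply: eq_from_tnth => i; rewrite tnth_overwrite inE.
by case: eqP.
Qed.

Lemma diff_overwrite (H : {set 'I_n}) : H \subset D ->
  [set i | tnth x i != tnth (overwrite x xs H) i] = H.
Proof.
move=> sHD; apply/setP => i; rewrite inE tnth_overwrite.
case: ifP => [/(subsetP sHD) | _]; last by rewrite eqxx.
by rewrite inE.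
Qed.

(** H |-> x_H is a bijection from the subsets of D of size h onto N^h(xs, x); its
    inverse sends y to the set of coordinates on which y differs from x. *)
Lemma sum_mixed_at (R : comNzRingType) h (F : n.-tuple 'I_q -> R) :
  \sum_(y in mixed_at h xs x) F y
    = \sum_(H : {set 'I_n} | (H \subset D) && (#|H| == h)) F (overwrite x xs H).
Proof.
rewrite (reindex_onto (overwrite x xs)
  (fun y => [set i | tnth x i != tnth y i])) /=.
  apply: eq_bigl => H; rewrite inE /hamming.
  apply/andP/andP => [[/andP[_ cH] /eqP dH] | [sHD cH]].
    move: cH; rewrite dH => ->; split=> //; apply/subsetP => i.
    by rewrite -{1}dH !inE tnth_overwrite; case: ifP => //; rewrite eqxx.
  rewrite diff_overwrite // cH andbT; split=> //; apply/forallP => i.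
  by rewrite tnth_overwrite !inE; case: ifP; rewrite eqxx ?orbT.
move=> y; rewrite inE => /andP[/forallP mix_y _]; apply: eq_from_tnth => i.
rewrite tnth_overwrite inE; have := mix_y i; rewrite !inE.
case: (eqVneq (tnth x i) (tnth y i)) => //= _.
by rewrite orbF => /eqP.
Qed.

(** The trace is taken on D :&: J and not on J so that it is a subset of D, as
    [extrapolate_trace] requires. *)
Lemma map_overwrite_trace (a : nat) (J : a.-tuple 'I_n) (H : {set 'I_n}) :
  H \subset D ->
  map_tuple (tnth (overwrite x xs H)) J
    = map_tuple (tnth (overwrite x xs (H :&: (D :&: [set j in J])))) J.
Proof.
move=> sHD; apply/val_inj/eq_in_map => j jJ /=; rewrite !tnth_overwrite !inE jJ.
rewrite andbT; case: (boolP (j \in H)) => //= /(subsetP sHD).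
by rewrite inE => ->.
Qed.

End Overwrite.

Theorem theorem4p3 (R : realType) (q k n : nat) (hq : (2 <= q)%N) (hk : (2 <= k)%N)
    (I : csp R q k n) (x xs : n.-tuple 'I_q) (kappa : nat)
    (hdist : hamming x xs = kappa) (hkappa : (k < kappa)%N) :
  csp_value I xs =
    \sum_(0 <= h < k.+1)
      (-1) ^+ (k - h) * 'C(kappa - 1 - h, k - h)%:R
      * \sum_(y in mixed_at h xs x) csp_value I y.
Proof.
pose D : {set 'I_n} := [set i | tnth x i != tnth xs i].
have ltkD : (k < #|D|)%N by rewrite -/(hamming x xs) hdist.
transitivity (extrapolate D k (fun H => csp_value I (overwrite x xs H)));
  last first.
  rewrite /extrapolate -/(hamming x xs) hdist.
  by apply: eq_bigr => h _; rewrite sum_mixed_at.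
rewrite extrapolate_sum -{1}(overwrite_diff x xs); apply: eq_bigr => i _.
rewrite extrapolateZ; congr (_ * _).
pose g H := csp_fun (map_tuple (tnth (overwrite x xs H)) (csp_support i)).
pose S := D :&: [set j in csp_support i].
rewrite map_overwrite_trace // -/D -/S -/(g _) (setIidPr (subsetIl _ _)).
rewrite -(@extrapolate_trace _ _ D k S) ?subsetIl //.
  by apply: eq_extrapolate => H sHD; rewrite /g [in RHS]map_overwrite_trace.
have /andP[_] := csp_arity_bounds i; rewrite leq_min => /andP[leak _].
apply: leq_trans (subset_leq_card (subsetIr _ _)) (leq_trans _ leak).
by rewrite cardsE -{2}(size_tuple (csp_support i)) card_size.
Qed.
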